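(* The assignment $(c_1(z),\dots,c_n(z))\mapsto\sum_{j=1}^nc_j(z)\frac{\Phi(x,z)}{x-z_j}$ gives an isomorphism of $\mathbb{F}_p(z)$-vector spaces $$\operatorname{Ann}(\mathcal{M}_{\mathbb{F}_p(z)})\ \simeq\ \Omega_{\log}\cap\partial\big(\mathbb{F}_p(z)[x]_{\le Mn}\big).$$
   Context: Let $p,q$ be prime numbers, $k$ a positive integer, $n=kq+1$, and $p>n$. Let $z=(z_1,\dots,z_n)$, and let $\mathbb{F}_p(z)=\mathbb{F}_p(z_1,\dots,z_n)$ be the field of rational functions. Let $a$ be the unique integer with $1\le a<q$ and $q\mid(ap-1)$; put $M=(ap-1)/q\in\mathbb{Z}_{>0}$. Let $\Phi(x,z)=\prod_{i=1}^n(x-z_i)^M$ over $\mathbb{F}_p$, and define vectors $P^i(z)=(P^i_1(z),\dots,P^i_n(z))\in\mathbb{F}_p[z_1,\dots,z_n]^n$ by the expansion $$\Big(\frac{\Phi(x,z)}{x-z_1},\dots,\frac{\Phi(x,z)}{x-z_n}\Big)=\sum_i P^i(z)\,x^i .$$ The vectors $P^{lp-1}(z)$, $l=1,\dots,ak$, are called arithmetic solutions, and $\mathcal{M}_{\mathbb{F}_p(z)}$ is the $\mathbb{F}_p(z)$-subspace of $\mathbb{F}_p(z)^n$ spanned by them. Its annihilator is $$\operatorname{Ann}(\mathcal{M}_{\mathbb{F}_p(z)})=\Big\{(c_1,\dots,c_n)\in\mathbb{F}_p(z)^n\ \Big|\ \sum_{j=1}^nc_j(z)P^{lp-1}_j(z)=0,\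 l=1,\dots,ak\Big\}.$$ $\mathbb{F}_p(z)[x]_{\le m}$ is the $\mathbb{F}_p(z)$-vector space of polynomials in $x$ of degree at most $m$ with coefficients in $\mathbb{F}_p(z)$. The map $\partial:\mathbb{F}_p(z)[x]_{\le Mn}\to\mathbb{F}_p(z)[x]_{\le Mn-1}$ is $Q\mapsto\frac{\partial Q}{\partial x}$. The space $\Omega_{\log}$ is the $\mathbb{F}_p(z)$-span of the polynomials $\frac{\Phi(x,z)}{x-z_j}$, $j=1,\dots,n$. *)

(* Defs.v *)
From HB Require Import structures.
From mathcomp Require Import all_boot all_order all_algebra.
From mathcomp Require Import mpoly.

Set Implicit Arguments.
Unset Strict Implicit.
Unset Printing Implicit Defensive.

Import GRing.Theory.
Local Open Scope ring_scope.

Section Division.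

Variables (R : idomainType) (n M : nat) (x : 'I_n -> R).

Lemma prod_XsubC_divK j : (0 < M)%N ->
  (\prod_(i < n) ('X - (x i)%:P) ^+ M) %/ ('X - (x j)%:P) * ('X - (x j)%:P)
  = \prod_(i < n) ('X - (x i)%:P) ^+ M.
Proof.
move=> M0; apply: Pdiv.IdomainUnit.divpK.
  by rewrite (monicP (monicXsubC _)) unitr1.
rewrite (bigD1 j) //= -(prednK M0) exprS -mulrA.
exact: Pdiv.Idomain.dvdp_mulIl.
Qed.

Lemma size_prod_XsubC_div j :
  (size ((\prod_(i < n) ('X - (x i)%:P) ^+ M)%R %/ ('X - (x j)%:P))%R
     <= M * n)%N.
Proof.
rewrite Pdiv.Idomain.size_divp ?polyXsubC_eq0 // size_XsubC size_prod.
  rewrite (eq_bigr (fun=> M.+1)) => [|i _]; last by rewrite size_exp_XsubC.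
  by rewrite sum_nat_const card_ord mulnS -addnS addKn mulnC subn1.
by move=> i _; rewrite expf_neq0 // polyXsubC_eq0.
Qed.

End Division.

(* F_p[z_1, ..., z_n] and its field of fractions.  For prime p, 'F_p is the   *)
(* field with p elements.                                                     *)
Notation polFp p n := {mpoly 'F_p[n]}.
Notation ratFp p n := {fraction polFp p n}.

Section ArithmeticSolutions.

Variables (p n M : nat).
Local Notation A := (polFp p n).
Local Notation K := (ratFp p n).

Definition Phi : {poly A} := \prod_(i < n) ('X - ('X_i : A)%:P) ^+ M.

(* The division is performed in F_p[z][x] by a monic polynomial; it is exact  *)
(* for M > 0 by Phi_overK.                                                    *)
Definition Phi_over (j : 'I_n) : {poly A} := Phi %/ ('X - ('X_j : A)%:P).

Lemma Phi_overK j : (0 < M)%N -> Phi_over j * ('X - ('X_j : A)%:P) = Phi.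
Proof. exact: (prod_XsubC_divK (fun i => 'X_i : A)). Qed.

Lemma size_Phi_over j : (size (Phi_over j) <= M * n)%N.
Proof. exact: (size_prod_XsubC_div M (fun i => 'X_i : A)). Qed.

(* P^i(z), the coefficient of x^i in (Phi/(x - z_1), ..., Phi/(x - z_n)).     *)
Definition Pvec (i : nat) : 'rV[A]_n := \row_j (Phi_over j)`_i.

Definition Phi_over_rat (j : 'I_n) : {poly K} :=
  map_poly (@tofrac A) (Phi_over j).

Lemma size_Phi_over_rat j : (size (Phi_over_rat j) <= M * n)%N.
Proof. exact: leq_trans (size_poly _ _) (size_Phi_over j). Qed.

(* {poly_m K} is K[x]_{<= m - 1}.                                             *)
Definition Phi_npoly (j : 'I_n) : {poly_(M * n) K} :=
  NPoly (size_Phi_over_rat j).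

Definition Omega_log : {vspace {poly_(M * n) K}} :=
  <<[seq Phi_npoly j | j <- enum 'I_n]>>%VS.

Fact size_pder (Q : {poly_((M * n).+1) K}) :
  (size ((Q : {poly K})^`()) <= M * n)%N.
Proof.
have [->|Q0] := eqVneq (Q : {poly K}) 0; first by rewrite deriv0 size_poly0.
by rewrite -ltnS (leq_trans (lt_size_deriv Q0)) // size_npoly.
Qed.

Definition pder (Q : {poly_((M * n).+1) K}) : {poly_(M * n) K} :=
  NPoly (size_pder Q).

Fact pder_is_linear : linear pder.
Proof. by move=> c Q1 Q2; apply/val_inj; rewrite /= derivD derivZ. Qed.

HB.instance Definition _ :=
  GRing.isLinear.Build K {poly_((M * n).+1) K} {poly_(M * n) K} _ pder
    pder_is_linear.

Definition im_pder : {vspace {poly_(M * n) K}} := (linfun pder @: fullv)%VS.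

Lemma mem_im_pder (R : {poly_(M * n) K}) :
  reflect (exists Q, R = pder Q) (R \in im_pder).
Proof.
apply: (iffP memv_imgP) => [[Q _ ->]|[Q ->]]; exists Q => //.
  by rewrite lfunE.
by rewrite memvf.
by rewrite lfunE.
Qed.

(* The annihilator of the vectors P^{lp-1}, l = 1, ..., d, written as the     *)
(* kernel of c |-> (sum_j c_j P^{lp-1}_j)_l; column l of arith_mx, which      *)
(* is indexed from 0, is P^{(l+1)p-1}.  See mem_Ann.                          *)
Definition arith_mx (d : nat) : 'M[K]_(n, d) :=
  \matrix_(j, l) tofrac (Pvec (l.+1 * p - 1) 0 j).

Definition Ann (d : nat) : {vspace 'rV[K]_n} :=
  lker (linfun (mulmxr (arith_mx d) : 'rV[K]_n -> 'rV[K]_d)).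

Lemma mem_Ann d (c : 'rV[K]_n) :
  reflect (forall l : nat, (1 <= l <= d)%N ->
             \sum_(j < n) c 0 j * tofrac (Pvec (l * p - 1) 0 j) = 0)
          (c \in Ann d).
Proof.
rewrite memv_ker lfunE /=; apply: (iffP eqP) => [Ec [//|l] /andP[_ ld]|Ec].
  have /rowP/(_ (Ordinal ld)) := Ec; rewrite !mxE => E0; rewrite -[RHS]E0.
  by apply: eq_bigr => j _; rewrite !mxE.
apply/rowP=> l; rewrite !mxE -[RHS](Ec l.+1) ?ltn_ord //.
by apply: eq_bigr => j _; rewrite !mxE.
Qed.

End ArithmeticSolutions.

(* Main.v *)
Require Import Defs.
From HB Require Import structures.
From mathcomp Require Import all_boot all_order all_algebra.
From mathcomp Require Import mpoly.

(** Multiplying a relation [\sum_j c_j Phi / (x - z_j) = 0] by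
[\prod_i (x - z_i) / Phi] and evaluating at [z_j] yields [c_j = 0], so the
assignment is injective on all of [F_p(z)^n], with image [Omega_log].  In
characteristic [p] a polynomial is a derivative exactly when its coefficients
of [x^(lp-1)] all vanish.  Since [M n = a k p + (M - k) < (a k + 1) p], on
polynomials of degree less than [M n] only [l = 1, ..., a k] matter, and these
are the equations defining the annihilator. *)

Import GRing.Theory.
Local Open Scope ring_scope.

(** The last hypothesis makes [U] the full preimage of [W], so [g] restricts to [U]; since [W] lies
    in the image, [g^-1] restricted to [W] is a two-sided inverse. *)
Lemma restrict_lfun_iso (F : fieldType) (vT wT : vectType F)
    (g : 'Hom(vT, wT)) (U : {vspace vT}) (W : {vspace wT}) :
    injective g -> (W <= limg g)%VS -> (forall v, (g v \in W) = (v \in U)) ->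
  exists f : {linear subvs_of U -> subvs_of W},
    (forall u, vsval (f u) = g (vsval u)) /\ bijective f.
Proof.
move=> /lker0P g_inj sWg memW.
pose f : {linear subvs_of U -> subvs_of W} := vsproj W \o (g \o vsval).
have fE u : vsval (f u) = g (vsval u).
  by rewrite /f /= vsprojK // memW subvsP.
exists f; split=> //.
have gVK w : w \in W -> g ((g^-1)%VF w) = w.
  by move=> Ww; apply: limg_lfunVK; apply: subvP Ww.
exists (fun w => vsproj U ((g^-1)%VF (vsval w))) => [u|w]; apply: val_inj => /=.
  by rewrite fE lker0_lfunK // vsprojK ?subvsP.
by rewrite fE vsprojK ?gVK ?subvsP // -memW gVK ?subvsP.
Qed.

Lemma prod_XsubC_free (F : fieldType) (n : nat) (x c : 'I_n -> F) :
    injective x ->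
    \sum_(j < n) c j *: \prod_(i < n | i != j) ('X - (x i)%:P) = 0 ->
  forall j, c j = 0.
Proof.
move=> x_inj sum0 j; have /eqP := congr1 (horner^~ (x j)) sum0.
rewrite horner0 horner_sum (bigD1 j) //= [X in _ + X]big1 => [|i ne_ij].
  rewrite addr0 hornerZ mulf_eq0 => /orP[/eqP //|].
  rewrite horner_prod => /prodf_eq0[i ne_ij].
  by rewrite hornerXsubC subr_eq0 (inj_eq x_inj) eq_sym (negPf ne_ij).
(* The summand of index [i != j] keeps the factor ['X - (x j)%:P], which vanishes at [x j]. *)
rewrite hornerZ horner_prod (bigD1 j) /=; last by rewrite eq_sym.
by rewrite hornerXsubC subrr mul0r mulr0.
Qed.

Lemma natr_rat_eq0 (p n m : nat) : prime p ->
  ((m%:R : ratFp p n) == 0) = (p %| m)%N.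
Proof.
move=> pr_p.
have -> : (m%:R : ratFp p n) = tofrac (m%:R : polFp p n).
  by rewrite rmorph_nat.
rewrite tofrac_eq0 -(rmorph_nat (@mpolyC n 'F_p)) mpolyC_eq0.
by rewrite -(dvdn_pcharf (pchar_Fp pr_p)).
Qed.

(** Differentiating [x^(lp)] gives the coefficient [lp = 0], whereas any exponent prime to [p] is
    invertible and allows termwise integration. *)
Lemma im_pderP (p n M : nat) (R : {poly_(M * n) ratFp p n}) : prime p ->
  reflect (forall l, (0 < l)%N -> (R : {poly _})`_(l * p - 1) = 0)
          (R \in im_pder p n M).
Proof.
move=> pr_p; have p_gt0 := prime_gt0 pr_p.
apply: (iffP (mem_im_pder R)) => [[Q ->] l l_gt0 | R0].
  rewrite /= coef_deriv subn1 prednK ?muln_gt0 ?l_gt0 //.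
  by apply/eqP; rewrite -mulr_natr mulf_eq0 natr_rat_eq0 // dvdn_mull ?orbT.
(* Termwise antiderivative. Since [0^-1 = 0], its coefficients at multiples of [p], including the
   constant term, are 0. *)
pose q : {poly ratFp p n} :=
  \poly_(i < (M * n).+1) ((R : {poly _})`_i.-1 / i%:R).
have size_q : (size q <= (M * n).+1)%N by apply: size_poly.
exists (NPoly size_q); apply/val_inj/polyP => i /=.
rewrite coef_deriv coef_poly ltnS.
case: ltnP => [lt_i | ge_i]; last first.
  by rewrite mul0rn nth_default // (leq_trans _ ge_i) // size_npoly.
rewrite -[RHS]mulr_natr /=; have [p_dvd | p_ndvd] := boolP (p %| i.+1)%N.
  have -> : (R : {poly _})`_i = 0.
    (* Here [i = l * p - 1], and [l] is positive because [i.+1] is nonzero. *)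
    have /dvdnP[l def_l] := p_dvd; have := R0 l.
    by rewrite -def_l subn1; apply; case: l def_l.
  by rewrite !mul0r.
by rewrite divfK // natr_rat_eq0.
Qed.

Section PhiOver.

Variables (p n M : nat).
Hypothesis M_gt0 : (0 < M)%N.
Local Notation A := (polFp p n).
Local Notation K := (ratFp p n).
Local Notation z i := (tofrac ('X_i : A)).

Lemma tofrac_mpolyX_inj : injective (fun i : 'I_n => z i).
Proof.
move=> i j /eqP; rewrite tofrac_eq => /eqP/(congr1 (mcoeff U_(i))) /eqP.
by rewrite !mcoeffXU eqxx; case: (j =P i) => [->|_] //; rewrite oner_eq0.
Qed.

(** This isolates a factor common to all [j], leaving squarefree products to which [prod_XsubC_free]
    applies. [Phi_over] is a quotient over F_p[z], so the two sides are compared after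
    multiplication by [x - z_j]. *)
Lemma Phi_over_ratE j : Phi_over_rat p M j =
  \prod_(i < n) ('X - (z i)%:P) ^+ M.-1 *
  \prod_(i < n | i != j) ('X - (z i)%:P).
Proof.
have map_X i : map_poly (@tofrac A) ('X - ('X_i)%:P) = 'X - (z i)%:P.
  by rewrite rmorphB /= map_polyX map_polyC.
have Xz_neq0 : 'X - (z j)%:P != 0 by rewrite polyXsubC_eq0.
apply: (mulIf Xz_neq0).
have /(congr1 (map_poly (@tofrac A))) := Phi_overK p j M_gt0.
rewrite rmorphM /= map_X => ->.
rewrite /Phi rmorph_prod /= -mulrA [X in _ = _ * X]mulrC.
rewrite -(bigD1 (P := xpredT) (F := fun i => 'X - (z i)%:P) j) //=.
rewrite -big_split /=; apply: eq_bigr => i _.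
by rewrite rmorphXn /= map_X -exprSr prednK.
Qed.

Lemma Phi_over_rat_free (c : 'rV[K]_n) :
  \sum_(j < n) c 0 j *: Phi_over_rat p M j = 0 -> c = 0.
Proof.
pose D := \prod_(i < n) ('X - (z i)%:P) ^+ M.-1.
have D_neq0 : D != 0.
  by apply/prodf_neq0 => i _; rewrite expf_neq0 ?polyXsubC_eq0.
move=> sum0.
have /(mulfI D_neq0) {}sum0 :
    D * (\sum_(j < n) c 0 j *: \prod_(i < n | i != j) ('X - (z i)%:P)) = D * 0.
  rewrite mulr0 -[RHS]sum0 mulr_sumr; apply: eq_bigr => j _.
  by rewrite Phi_over_ratE scalerAr.
apply/rowP=> j; rewrite [RHS]mxE.
exact: (prod_XsubC_free _ _ _ _ tofrac_mpolyX_inj sum0).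
Qed.

End PhiOver.

Section LogForm.

Variables (p n M : nat).
Local Notation K := (ratFp p n).

(** The assignment of the theorem on all of [K^n], before restriction to the annihilator. *)
Definition log_form (c : 'rV[K]_n) : {poly_(M * n) K} :=
  \sum_(j < n) c 0 j *: Phi_npoly p M j.

Fact log_form_is_linear : linear log_form.
Proof.
move=> a b c; rewrite /log_form scaler_sumr -big_split /=.
by apply: eq_bigr => j _; rewrite !mxE scalerDl scalerA.
Qed.

HB.instance Definition _ :=
  GRing.isLinear.Build K 'rV[K]_n {poly_(M * n) K} _ log_form
    log_form_is_linear.

Lemma log_formE c :
  log_form c = \sum_(j < n) c 0 j *: Phi_over_rat p M j :> {poly K}.
Proof. by rewrite /log_form; elim/big_rec2: _ => //= j _ Q _ <-. Qed.

Lemma coef_log_form c i :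
  (log_form c : {poly K})`_i = \sum_(j < n) c 0 j * tofrac (Pvec p n M i 0 j).
Proof.
rewrite log_formE coef_sum; apply: eq_bigr => j _.
by rewrite coefZ coef_map mxE.
Qed.

Lemma log_form_inj : (0 < M)%N -> injective log_form.
Proof.
move=> M_gt0; apply: raddf_inj => c c0; apply: (Phi_over_rat_free _ _ _ M_gt0).
by rewrite -log_formE c0.
Qed.

Lemma Omega_log_limg : Omega_log p n M = limg (linfun log_form).
Proof.
apply/eqP; rewrite eqEsubv; apply/andP; split.
  apply/span_subvP => _ /mapP[j _ ->]; apply/memv_imgP.
  exists (delta_mx 0 j); rewrite ?memvf // lfunE /= /log_form.
  rewrite (bigD1 j) //= big1 ?addr0 => [|i ne_ij]; rewrite mxE eqxx /=.
    by rewrite eqxx scale1r.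
  by rewrite (negPf ne_ij) scale0r.
apply/subvP=> _ /memv_imgP[c _ ->]; rewrite lfunE /=.
apply: rpred_sum => j _; apply/rpredZ/memv_span/map_f.
by rewrite mem_enum.
Qed.

End LogForm.

Lemma log_form_in_im_pder (p n M d : nat) (c : 'rV[ratFp p n]_n) :
    prime p -> (M * n < d.+1 * p)%N ->
  (log_form _ _ M c \in im_pder p n M) = (c \in Ann p n M d).
Proof.
move=> pr_p lt_d; apply/(im_pderP _ _ _ _ pr_p)/mem_Ann => c0 l.
  by case/andP=> l_gt0 _; rewrite -(coef_log_form p n M) c0.
move=> l_gt0; have [le_ld | lt_dl] := leqP l d.
  by rewrite coef_log_form c0 ?l_gt0.
(* For [l > d], [M * n < d.+1 * p <= l * p], so the index [l * p - 1] is at least [M * n] and the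
   coefficient is zero. *)
rewrite nth_default // (leq_trans (size_npoly _)) //.
have := leq_mul2r p d.+1 l; rewrite lt_dl orbT => le_dl.
by rewrite leq_subRL ?muln_gt0 ?l_gt0 ?prime_gt0 // add1n (leq_trans lt_d).
Qed.

Lemma degree_bound (p q k a M : nat) :
    (0 < p)%N -> (0 < a < q)%N -> (M * q = a * p - 1)%N ->
  (M * (k * q + 1) < (a * k).+1 * p)%N.
Proof.
move=> p_gt0 /andP[a_gt0 lt_aq] def_Mq.
have q_gt0 := ltn_trans a_gt0 lt_aq.
(* Since [a < q], [M * q = a * p - 1 < q * p]. *)
have lt_Mp : (M < p)%N.
  rewrite -(ltn_pmul2r q_gt0) def_Mq ltn_subLR ?muln_gt0 ?a_gt0 // add1n ltnS.
  by rewrite mulnC leq_mul2l ltnW ?orbT.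
have -> : (M * (k * q + 1) = k * (M * q) + M)%N.
  by rewrite mulnDr muln1 mulnCA.
rewrite def_Mq mulSn addnC -mulnA mulnCA -addSn leq_add //.
by rewrite leq_mul2l leq_subr orbT.
Qed.

Theorem corollary3p7 (p q k n a M : nat)
    (pr_p : prime p) (pr_q : prime q) (k_gt0 : (0 < k)%N)
    (def_n : n = (k * q + 1)%N) (lt_np : (n < p)%N)
    (a_gt0 : (1 <= a)%N) (lt_aq : (a < q)%N)
    (dvd_q : (q %| a * p - 1)%N) (def_M : M = ((a * p - 1) %/ q)%N) :
  exists f : {linear subvs_of (Ann p n M (a * k)) ->
                     subvs_of (Omega_log p n M :&: im_pder p n M)%VS},
    (forall c : subvs_of (Ann p n M (a * k)),
       vsval (f c) = \sum_(j < n) (vsval c) 0 j *: Phi_over_rat p M j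
         :> {poly ratFp p n})
    /\ bijective f.
Proof.
have def_Mq : (M * q = a * p - 1)%N by rewrite def_M divnK.
have M_gt0 : (0 < M)%N.
  have : (0 < M * q)%N.
    by rewrite def_Mq subn_gt0 (leq_trans (prime_gt1 pr_p)) ?leq_pmull.
  by rewrite muln_gt0 => /andP[].
have bound : (M * n < (a * k).+1 * p)%N.
  rewrite def_n; apply: degree_bound def_Mq; first exact: prime_gt0.
  by rewrite a_gt0.
pose g := linfun (log_form p n M).
have [||c|f [fE f_bij]] := restrict_lfun_iso _ _ _ g (Ann p n M (a * k))
  (Omega_log p n M :&: im_pder p n M)%VS.
- by move=> c d; rewrite !lfunE => /(log_form_inj _ _ _ M_gt0).
- by rewrite Omega_log_limg capvSl.
(* Every value of [g] lies in [Omega_log], so only being a derivative remains to be matched with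
   [Ann]. *)
- rewrite memv_cap Omega_log_limg memv_img ?memvf //= lfunE /=.
  exact: log_form_in_im_pder.
by exists f; split=> // c; rewrite fE lfunE /= log_formE.
Qed.
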